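(* Let $n\ge 1$ and $k\in\mathbb{Z}$. The quantum line bundle $L_k=C(\mathbb{S}_q^{2n+1})_k$ of degree $k$ over $C(\mathbb{C}P_q^n)$ is isomorphic, as a left $C(\mathbb{C}P_q^n)$-module, to the finitely generated projective left module over $C(\mathbb{C}P_q^n)$ determined by the projection $$P_{-|k|}\otimes(\otimes^{n-1}I)\qquad\text{if } k\le 0$$ (with $P_{-0}:=I$), and by the projection $$\boxplus_{j=0}^{n}\Big(\boxplus^{C_j^{k+j-1}}\big((\otimes^{j}P_1)\otimes(\otimes^{n-j}I)\big)\Big)\qquad\text{if } k>0,$$ where $C_j^{m}=m!/(j!(m-j)!)$ denotes the binomial coefficient.
   Context: **The algebras.** Let $\mathbb{Z}_{\ge}=\{0,1,2,\dots\}$, $\overline{\mathbb{Z}}=\mathbb{Z}\cup\{\infty\}$ ($\mathbb{Z}$ discrete, $\infty$ adjoined as limit point at the positive end), and $\overline{\mathbb{Z}}_{\ge}=\mathbb{Z}_{\ge}\cup\{\infty\}$ (one-point compactification of $\mathbb{Z}_{\ge}$). $\mathbb{Z}^n$ acts on $\overline{\mathbb{Z}}^n$ by componentwise translation, fixing $\infty$. Let $\mathcal{F}^n=\mathbb{Z}\times(\mathbb{Z}^n\ltimes\overline{\mathbb{Z}}^n)|_{\overline{\mathbb{Z}}_{\ge}^n}$ be the étale groupoid of triples $(z,x,w)$ with $z\in\mathbb{Z}$, $x\in\mathbb{Z}^n$, $w\in\overline{\mathbb{Z}}_{\ge}^n$, $x+w\in\overline{\mathbb{Z}}_{\ge}^n$,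 with source $w$, target $x+w$, and product $(z,x,w)(z',x',w')=(z+z',x+x',w')$ when $w=x'+w'$. Let $\widetilde{\mathfrak{F}_n}\subset\mathcal{F}^n$ be the subgroupoid of all $(z,x,w)$ such that, for each $1\le i\le n$, $w_i=\infty$ implies $x_i=-z-x_1-\cdots-x_{i-1}$ and $x_{i+1}=\cdots=x_n=0$. Let $\sim$ be the equivalence relation generated by $(z,x,w)\sim(z,x,w_1,\dots,w_i=\infty,\infty,\dots,\infty)$ for all $(z,x,w)$ and $i$ with $w_i=\infty$, and let $\mathfrak{F}_n=\widetilde{\mathfrak{F}_n}/\sim$ with the quotient topology and induced groupoid structure. The C*-algebra $C(\mathbb{S}_q^{2n+1})$ of the (Vaksman–Soibelman) quantum homogeneous sphere is identified with the groupoid C*-algebra $C^*(\mathfrak{F}_n)$ (this may be taken as its definition), with convolution product $(f*g)(\gamma)=\sum_{\alpha\beta=\gamma}f(\alpha)g(\beta)$ on $C_c(\mathfrak{F}_n)$. **Grading.** There is a $U(1)$-action $\rho$ on $C^*(\mathfrak{F}_n)$ determined by $(\rho(t)f)([(z,x,w)])=t^z f([(z,x,w)])$ for $f\in C_c(\mathfrak{F}_n)$, $t\in\mathbb{T}$; it coincides with the action on $C(\mathbb{S}_q^{2n+1})$ multiplying each standard generator by $t$. For $k\in\mathbb{Z}$, $C(\mathbb{S}_q^{2n+1})_k=\{a: \rho(t)(a)=t^k a\ \text{for all } t\in\mathbb{T}\}$ is the degree-$k$ spectral subspace; it is the closure of $C_c((\mathfrak{F}_n)_k)$ where $(\mathfrak{F}_n)_k=\{[(z,x,w)]\in\mathfrak{F}_n:z=k\}$.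 The algebra of the quantum complex projective space is $C(\mathbb{C}P_q^n)=C(\mathbb{S}_q^{2n+1})_0=C^*((\mathfrak{F}_n)_0)$. The quantum line bundle $L_k=C(\mathbb{S}_q^{2n+1})_k$ is a left $C(\mathbb{C}P_q^n)$-module under multiplication in $C(\mathbb{S}_q^{2n+1})$. **Projections.** $C(\mathbb{C}P_q^n)$ is faithfully represented on $\ell^2(\mathbb{Z}_{\ge}^n)=\ell^2(\mathbb{Z}_{\ge})^{\otimes n}$ by $\pi_n(f)e_w=\sum_x f([(0,x,w)])e_{x+w}$ for $f\in C_c((\mathfrak{F}_n)_0)$, and is identified with its image. $I$ is the identity operator on $\ell^2(\mathbb{Z}_{\ge})$, $P_m$ ($m\ge 0$) is the projection onto the span of the first $m$ basis vectors $e_0,\dots,e_{m-1}$, and $P_{-m}=I-P_m$ for $m>0$, with $P_{-0}=I$. The projection $P_{-m}\otimes(\otimes^{n-1}I)$ lies in $C(\mathbb{C}P_q^n)$, being the image of the characteristic function of the set of units $[(0,0,w)]$ with $w_1\ge m$; likewise $(\otimes^jP_1)\otimes(\otimes^{n-j}I)$ is the image of the characteristic function of the set of units $[(0,0,w)]$ with $w_1=\cdots=w_j=0$. $\boxplus$ denotes the block-diagonal sum of matrices and $\boxplus^r P$ the sum of $r$ copies of $P$. A projection $P\in M_N(\mathcal{A})$ over a unital C*-algebra $\mathcal{A}$ determines the finitely generated projective left $\mathcal{A}$-module $\mathcal{A}^N P$. *)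

(* Defs.v *)
From HB Require Import structures.
From Stdlib Require Import Relation_Operators.
From mathcomp Require Import all_boot all_order all_algebra generic_quotient.
From mathcomp Require Import all_classical all_reals all_analysis.
From mathcomp Require Import complex.

Set Implicit Arguments.
Unset Strict Implicit.
Unset Printing Implicit Defensive.
Import Order.TTheory GRing.Theory Num.Theory.
Import numFieldNormedType.Exports.

Local Open Scope classical_set_scope.
Local Open Scope ring_scope.
Local Open Scope quotient_scope.

(* Unital complex C*-algebras.  The real-valued norm is part of the mixin,
   because Hierarchy Builder rejects the join of [algType] and
   [completeNormedModType] (both [GRing.PzSemiRing] and [Num.SemiNormedZmodule]
   are inherited by [Num.NumDomain], without an intermediate structure). *)
HB.mixin Record Algebra_isCstar (R : realType) A of GRing.Algebra R[i] A := {
  star : A -> A ;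
  cnorm : A -> R ;
  starD : forall a b, star (a + b) = star a + star b ;
  starZ : forall (c : R[i]) a, star (c *: a) = Num.conj c *: star a ;
  starM : forall a b, star (a * b) = star b * star a ;
  starK : involutive star ;
  cnormD : forall a b, cnorm (a + b) <= cnorm a + cnorm b ;
  cnormZ : forall (c : R[i]) a, cnorm (c *: a) = complex.Re `|c| * cnorm a ;
  cnorm_eq0 : forall a, cnorm a = 0 -> a = 0 ;
  cnormM : forall a b, cnorm (a * b) <= cnorm a * cnorm b ;
  cnorm_star : forall a, cnorm (star a * a) = cnorm a ^+ 2 ;
  cnorm_complete : forall u : nat -> A,
    (forall e : R, 0 < e -> exists N, forall p q, (N <= p)%N -> (N <= q)%N ->
       cnorm (u p - u q) < e) ->
    exists l : A, forall e : R, 0 < e -> exists N, forall p, (N <= p)%N ->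
       cnorm (u p - l) < e
}.

#[short(type="cstarAlgType")]
HB.structure Definition CstarAlgebra (R : realType) :=
  {A of GRing.Algebra R[i] A & Algebra_isCstar R A}.

Definition star_hom (R : realType) (A B : cstarAlgType R) (phi : A -> B) :=
  [/\ forall (c : R[i]) a b, phi (c *: a + b) = c *: phi a + phi b,
      forall a b, phi (a * b) = phi a * phi b
    & forall a, phi (star a) = star (phi a)].

Section Groupoid.
Variable n : nat.

(* [None] is the point at infinity of the compactification of [nat]. *)
Definition triple : topologicalType :=
  (discrete_topology int * {ptws 'I_n -> discrete_topology int}
   * {ptws 'I_n -> one_point_compactification nat})%type.

(* Coordinates are indexed from 0: the index [i] below is w_(i+1), x_(i+1). *)
Definition in_Ftilde (g : triple) : Prop :=
  let z : int := g.1.1 in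
  let x : 'I_n -> int := g.1.2 in
  let w : 'I_n -> option nat := g.2 in
  (forall i m, w i = Some m -> 0 <= x i + m%:Z) /\
  (forall i, w i = None ->
     x i = - z - \sum_(j < n | (j < i)%N) x j /\
     forall j : 'I_n, (i < j)%N -> x j = 0).

Definition Ftilde : topologicalType := [set g : triple | in_Ftilde g].

Definition Fz (a : Ftilde) : int := (val a).1.1.
Definition Fx (a : Ftilde) : 'I_n -> int := (val a).1.2.
Definition Fsrc (a : Ftilde) : 'I_n -> option nat := (val a).2.

(* The target x + w; [absz] is harmless since x i + m is nonnegative. *)
Definition Ftgt (a : Ftilde) : 'I_n -> option nat :=
  fun i => omap (fun m => absz (Fx a i + m%:Z)) (Fsrc a i).

Definition Fprod (a b c : Ftilde) : Prop :=
  [/\ Fsrc a = Ftgt b, Fz c = Fz a + Fz b,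
      Fx c = (fun i => Fx a i + Fx b i) & Fsrc c = Fsrc b].

Lemma Ftilde_inv_subproof (a : Ftilde) :
  ((- Fz a, fun i => - Fx a i, Ftgt a) : triple)
    \in [set g : triple | in_Ftilde g].
Proof.
have := valP a; rewrite !inE => -[h1 h2]; split => /= [i p|i].
  rewrite /Ftgt; case E: (Fsrc a i) => [m|//] [<-].
  by rewrite gez0_abs ?(h1 _ _ E)// addKr.
rewrite /Ftgt; case E: (Fsrc a i) => [//|] _.
have [h3 h4] := h2 i E; split => [|j ij]; last by rewrite /Fx h4 ?oppr0.
by rewrite /Fx h3 sumrN opprD !opprK.
Qed.

Definition Ftilde_inv (a : Ftilde) : Ftilde :=
  exist (fun g => g \in [set g : triple | in_Ftilde g]) _ (Ftilde_inv_subproof a).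

Definition Fstep (a b : Ftilde) : Prop :=
  exists i : 'I_n,
    [/\ Fsrc a i = None, Fz b = Fz a, Fx b = Fx a
      & Fsrc b = (fun j => if (j < i)%N then Fsrc a j else None)].

Definition Fsim (a b : Ftilde) : bool :=
  `[< clos_refl_sym_trans Ftilde Fstep a b >].

Lemma Fsim_refl : reflexive Fsim.
Proof. by move=> a; apply/asboolP; exact: rst_refl. Qed.

Lemma Fsim_sym : symmetric Fsim.
Proof.
by move=> a b; apply/asboolP/asboolP => h; exact: rst_sym.
Qed.

Lemma Fsim_trans : transitive Fsim.
Proof.
move=> b a c /asboolP h1 /asboolP h2; apply/asboolP.
exact: rst_trans h1 h2.
Qed.

Canonical Fsim_equiv := EquivRel Fsim Fsim_refl Fsim_sym Fsim_trans.

Definition Fn : topologicalType := quotient_topology {eq_quot Fsim_equiv}.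

Definition Fcl (a : Ftilde) : Fn := (\pi_({eq_quot Fsim_equiv}) a).
Definition Frepr (g : Fn) : Ftilde := repr (g : {eq_quot Fsim_equiv}).

(* The graph of the partial product of the quotient groupoid. *)
Definition Fmul (g h gh : Fn) : Prop :=
  exists a b c, [/\ g = Fcl a, h = Fcl b, gh = Fcl c & Fprod a b c].

(* Inversion and z are compatible with the equivalence relation, so the
   representative is immaterial. *)
Definition Finv (g : Fn) : Fn := Fcl (Ftilde_inv (Frepr g)).
Definition Fdeg (g : Fn) : int := Fz (Frepr g).

End Groupoid.

Section GroupoidAlgebra.
Variables (R : realType) (n : nat).
Implicit Types f g : Fn n -> R[i].

(* [R[i]^o] is [R[i]] with its norm topology. *)
Definition Cc : set (Fn n -> R[i]) :=
  [set f | continuous (f : Fn n -> R[i]^o) /\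
           compact (closure [set u | f u != 0])].

Definition conv f g : Fn n -> R[i] :=
  fun u => \sum_(p \in [set p : Fn n * Fn n | Fmul p.1 p.2 u]) f p.1 * g p.2.

Definition invol f : Fn n -> R[i] := fun u => Num.conj (f (Finv u)).

(* Only the restriction of [phi] to [Cc] matters, here and below. *)
Definition Cc_star_hom (B : cstarAlgType R) (phi : (Fn n -> R[i]) -> B) :=
  [/\ forall (c : R[i]) f g, Cc f -> Cc g ->
        phi (fun u => c * f u + g u) = c *: phi f + phi g,
      forall f g, Cc f -> Cc g -> phi (conv f g) = phi f * phi g
    & forall f, Cc f -> phi (invol f) = star (phi f)].

(* [A], with [iota : C_c(F_n) -> A], is the groupoid C*-algebra C*(F_n), i.e.
   the enveloping C*-algebra of the *-algebra C_c(F_n).  Since the unit space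
   of F_n is compact, C*(F_n) is unital; and since every C*-algebra embeds in
   a unital one and [Cc_star_hom], [star_hom] do not demand that units be
   preserved, it is enough to let [B] range over unital C*-algebras. *)
Definition is_groupoid_cstar (A : cstarAlgType R)
    (iota : (Fn n -> R[i]) -> A) : Prop :=
  [/\ Cc_star_hom iota,
      forall (a : A) (e : R), 0 < e ->
        exists2 f, Cc f & cnorm (a - iota f) < e
    & forall (B : cstarAlgType R) (phi : (Fn n -> R[i]) -> B),
        Cc_star_hom phi ->
        exists2 psi : A -> B, star_hom psi & forall f, Cc f -> psi (iota f) = phi f].

(* [rho t] is only relevant for [t] on the unit circle. *)
Definition is_gauge_action (A : cstarAlgType R)
    (iota : (Fn n -> R[i]) -> A) (rho : R[i] -> A -> A) : Prop :=
  [/\ forall t, `|t| = 1 -> star_hom (rho t),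
      forall a, rho 1 a = a,
      forall s t a, `|s| = 1 -> `|t| = 1 -> rho (s * t) a = rho s (rho t a)
    & forall t f, `|t| = 1 -> Cc f ->
        rho t (iota f) = iota (fun u => t ^ Fdeg u * f u)].

(* An operator T on l^2(Z_>=^n) is given by its matrix coefficients:
   [T w v] is the coordinate of T e_w along e_v.  Likewise on l^2(Z_>=). *)
Definition op1 := nat -> nat -> R[i].
Definition opn := ('I_n -> nat) -> ('I_n -> nat) -> R[i].

(* The coordinate along e_v of \sum_x f([(0,x,w)]) e_(x+w). *)
Definition pi_n f : opn := fun w v =>
  \sum_(a \in [set a : Ftilde n | [/\ Fz a = 0,
      Fsrc a = (fun i => Some (w i)) & Ftgt a = (fun i => Some (v i))]])
    f (Fcl a).

Definition tensor (T : 'I_n -> op1) : opn :=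
  fun w v => \prod_(i < n) T i (w i) (v i).

Definition idop : op1 := fun w v => (w == v)%:R.
Definition Pproj (m : nat) : op1 := fun w v => ((w == v) && (w < m)%N)%:R.
(* P_(-m), including P_(-0) = I. *)
Definition Pneg (m : nat) : op1 := fun w v => idop w v - Pproj m w v.

Definition line_proj (m : nat) : opn :=
  tensor (fun i => if i == 0%N :> nat then Pneg m else idop).

Definition corner_proj (j : nat) : opn :=
  tensor (fun i => if (i < j)%N then Pproj 1 else idop).

(* [f] in C_c((F_n)_0) is sent by pi_n to the operator [T]. *)
Definition represents f (T : opn) : Prop :=
  [/\ Cc f, forall u, f u != 0 -> Fdeg u = 0 & pi_n f = T].

(* The characteristic function of the units [(0,0,w)], w in [W]. *)
Definition unit_char (W : set ('I_n -> option nat)) : Fn n -> R[i] :=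
  fun u => `[< exists a : Ftilde n,
    [/\ Fz a = 0, Fx a = (fun=> 0), W (Fsrc a) & u = Fcl a] >]%:R.

Definition line_char (m : nat) :=
  unit_char [set w | forall i : 'I_n, i = 0%N :> nat ->
                       forall p, w i = Some p -> (m <= p)%N].

Definition corner_char (j : nat) :=
  unit_char [set w | forall i : 'I_n, (i < j)%N -> w i = Some 0%N].

End GroupoidAlgebra.

Section Modules.
Variables (R : realType) (A : cstarAlgType R).

Definition spectral (rho : R[i] -> A -> A) (k : int) : set A :=
  [set a | forall t : R[i], `|t| = 1 -> rho t a = (t ^ k) *: a].

(* S^N P as a left module over the subalgebra [S] of [A]. *)
Definition proj_module (S : set A) (N : nat) (P : 'M[A]_N) : set 'rV[A]_N :=
  [set v | exists2 u : 'rV[A]_N, (forall i, S (u 0 i)) & v = u *m P].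

Definition left_module_iso (S : set A) (N : nat) (M : set A)
    (M' : set 'rV[A]_N) : Prop :=
  exists2 Phi : A -> 'rV[A]_N, set_bij M M' Phi &
    (forall a b, M a -> M b -> Phi (a + b) = Phi a + Phi b) /\
    (forall s a, S s -> M a -> Phi (s * a) = s *: Phi a).

End Modules.

(* Main.v *)
Require Import Defs.
From HB Require Import structures.
From Stdlib Require Import Relation_Operators.
From mathcomp Require Import all_boot all_order all_algebra generic_quotient.
From mathcomp Require Import all_classical all_reals all_analysis.
From mathcomp Require Import complex.
Import Order.TTheory GRing.Theory Num.Theory.
Import numFieldNormedType.Exports.
Local Open Scope classical_set_scope.
Local Open Scope ring_scope.
Set Implicit Arguments.
Unset Strict Implicit.

(* If v_p has degree -k, u_p has degree k and \sum_p v_p u_p = 1, then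
   a |-> (a v_p)_p is an isomorphism of L_k onto the module of the idempotent
   matrix (u_p v_q).  Such v_p and u_p are the characteristic functions of
   compact open bisections [(-k, x_p, w)], with w in S_p, and of their inverses,
   as soon as the targets x_p + S_p partition the unit space; the matrix is then
   diagonal, with the characteristic functions of the sources S_p as entries.
   For k <= 0, the single bisection with x = (k, 0, ..., 0) and w_1 >= |k| has
   all units as targets.  For k > 0, take for each j <= n and each (t_1, ..., t_j)
   with sum t < k the vector x = (t_1, ..., t_j, k - sum t, 0, ..., 0) and the
   sources w_1 = ... = w_j = 0: a target v lies in the piece of the t read off its
   first j coordinates, where j + 1 is the first index at which the partial sums
   of v reach k (j = n if there is none). *)

(** * Classes of the quotient groupoid *)

Section NormalForm.
Variable n : nat.
Implicit Types (w : 'I_n -> option nat) (x : 'I_n -> int) (a b c : Ftilde n).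

(** The normal form of a source under the relation that forgets all coordinates after an infinite
    one. *)
Definition nrm w : 'I_n -> option nat :=
  fun i => if [exists j : 'I_n, (j <= i)%N && (w j == None)] then None else w i.

Lemma nrm_None w (i j : 'I_n) : (i <= j)%N -> w i = None -> nrm w j = None.
Proof.
by move=> ij wi; rewrite /nrm; case: existsP => // -[]; exists i; rewrite ij wi.
Qed.

Lemma nrm_eq_None w (i : 'I_n) :
  nrm w i = None -> exists2 j : 'I_n, (j <= i)%N & w j = None.
Proof.
rewrite /nrm; case: existsP => [[j /andP[ji /eqP wj]] _|_ wi]; first by exists j.
by exists i.
Qed.

Lemma nrm_some w (i : 'I_n) p : nrm w i = Some p -> w i = Some p.
Proof. by rewrite /nrm; case: existsP. Qed.

Definition wshift x w : 'I_n -> option nat :=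
  fun i => omap (fun m => absz (x i + m%:Z)) (w i).

(** Translation fixes infinity, so it neither creates nor removes infinite coordinates. *)
Lemma nrm_wshift x w : nrm (wshift x w) = wshift x (nrm w).
Proof.
apply/funext => i; rewrite /nrm /wshift.
rewrite (_ : [exists j : 'I_n, _] = [exists j : 'I_n, (j <= i)%N && (w j == None)]).
  by case: ifP.
by apply: eq_existsb => j; case: (w j).
Qed.

Definition mkF (z : int) x w (h : in_Ftilde ((z, x, w) : triple n)) : Ftilde n :=
  exist (fun g => g \in [set g : triple n | in_Ftilde g]) (z, x, w) (mem_set h).

Lemma Ftilde_eq a b : Fz a = Fz b -> Fx a = Fx b -> Fsrc a = Fsrc b -> a = b.
Proof.
move=> ez ex es; apply: val_inj; move: ez ex es; rewrite /Fz /Fx /Fsrc.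
by case: (val a) => -[z x] w; case: (val b) => -[z' x'] w' /= -> -> ->.
Qed.

Lemma in_FtildeP a : in_Ftilde ((Fz a, Fx a, Fsrc a) : triple n).
Proof. by have := valP a; rewrite inE /Fz /Fx /Fsrc; case: (val a) => -[]. Qed.

Lemma Ftilde_inf a (i : 'I_n) : Fsrc a i = None ->
  Fx a i = - Fz a - \sum_(j < n | (j < i)%N) Fx a j /\
  forall j : 'I_n, (i < j)%N -> Fx a j = 0.
Proof. by have [_] := in_FtildeP a; exact. Qed.

(** An infinite coordinate [j] forces the displacements up to [j] to add up to [- Fz a] and the
    later ones to vanish; this gives the conditions at the newly infinite coordinates. *)
Lemma in_Ftilde_nrm a : in_Ftilde ((Fz a, Fx a, nrm (Fsrc a)) : triple n).
Proof.
split => /= [i m /nrm_some|i /nrm_eq_None[j ji wj]].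
  by have [+ _] := in_FtildeP a; exact.
have [h3 h4] := Ftilde_inf wj.
split => [|l il]; last by apply: h4; exact: leq_ltn_trans il.
move: ji; rewrite leq_eqVlt => /orP[/eqP/val_inj <-//|ji]; rewrite h4//.
have -> : \sum_(l < n | (l < i)%N) Fx a l =
    Fx a j + \sum_(l < n | (l < j)%N) Fx a l.
  rewrite (bigD1 j)//=; congr (_ + _); rewrite (bigID (fun l : 'I_n => (l < j)%N))/=.
  rewrite [X in _ + X]big1 ?addr0.
    apply: eq_bigl => l; case: (ltnP l j) => lj; rewrite ?andbF//.
    by rewrite (ltn_trans lj ji) andbT; apply: contraTneq lj => ->; rewrite ltnn.
  move=> l /andP[/andP[_ lj]].
  by rewrite -leqNgt leq_eqVlt => /orP[/eqP/val_inj jl|/h4//]; rewrite jl eqxx in lj.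
by rewrite h3 subrK subrr.
Qed.

Lemma rst_Fstep_nrm a :
  clos_refl_sym_trans _ (@Fstep n) a (mkF (in_Ftilde_nrm a)).
Proof.
have [/existsP[i0 /eqP wi0]|/existsPn h] := boolP [exists i, Fsrc a i == None].
  (* One generating step, taken at the first infinite coordinate, reaches the normal form. *)
  pose i := [arg min_(i < i0 | Fsrc a i == None) (i : nat)].
  apply: rst_step; exists i; rewrite /i; case: arg_minnP => [|j /eqP wj jmin].
    exact/eqP.
  split => //; apply/funext => l.
  case: ifP => [lj|/negbT]; last first.
    by rewrite -leqNgt => /nrm_None/(_ wj).
  rewrite /Fsrc/= /nrm; case: existsP => // -[l' /andP[l'l /jmin]].
  by rewrite leqNgt (leq_ltn_trans l'l lj).
rewrite [X in clos_refl_sym_trans _ _ _ X](_ : _ = a); first exact: rst_refl.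
apply: Ftilde_eq => //; apply/funext => i; rewrite /Fsrc/= /nrm.
by case: existsP => // -[j /andP[_]]; rewrite (negbTE (h j)).
Qed.

(** The three data are unchanged by each generator, and every triple is equivalent to its normal
    form. *)
Lemma FclP a b : Fcl a = Fcl b <->
  [/\ Fz a = Fz b, Fx a = Fx b & nrm (Fsrc a) = nrm (Fsrc b)].
Proof.
have FclE c d : Fcl c = Fcl d <-> clos_refl_sym_trans _ (@Fstep n) c d.
  by split => [/eqmodP/asboolP|h]; [|apply/eqmodP/asboolP].
rewrite FclE; split; last first.
  case=> ez ex es; apply: rst_trans (rst_Fstep_nrm a) _.
  rewrite [mkF _](_ : _ = mkF (in_Ftilde_nrm b)).
    exact: rst_sym (rst_Fstep_nrm b).
  exact: Ftilde_eq.
elim=> [{}a {}b [i [wi ez ex es]]|//|{}a {}b _ [ez ex es]|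
        {}a {}b c _ [ez ex es] _ [ez' ex' es']]; last 2 first.
- by split.
- by split; [rewrite ez|rewrite ex|rewrite es].
split => //; apply/funext => j; rewrite es /nrm.
have -> : [exists j0 : 'I_n, (j0 <= j)%N &&
    ((if (j0 < i)%N then Fsrc a j0 else None) == None)] =
  [exists j0 : 'I_n, (j0 <= j)%N && (Fsrc a j0 == None)].
  apply/existsP/existsP => -[l /andP[lj]].
    case: ifPn => [_ wl|]; first by exists l; rewrite lj.
    by rewrite -leqNgt => il _; exists i; rewrite (leq_trans il lj) wi.
  by move=> wl; exists l; rewrite lj; case: ifP.
case: ifPn => // /existsPn h; case: ifPn => //; rewrite -leqNgt => ij.
by have := h i; rewrite ij wi.
Qed.

Lemma Fdeg_Fcl a : Fdeg (Fcl a) = Fz a.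
Proof.
have /FclP[] // : Fcl (Frepr (Fcl a)) = Fcl a.
by rewrite /Fcl/= reprK.
Qed.

Lemma Fn_ind (P : Fn n -> Prop) : (forall a, P (Fcl a)) -> forall u, P u.
Proof. by move=> h u; rewrite -[u]reprK; exact: (h (repr u)). Qed.

End NormalForm.

(** * Compact open slices *)

Lemma clopen_cylinder (I : finType) (T : I -> topologicalType)
    (B : forall i, set (T i)) : (forall i, clopen (B i)) ->
  clopen [set f : prod_topology T | forall i, B i (f i)].
Proof.
move=> cB.
have -> : [set f : prod_topology T | forall i, B i (f i)] =
    \big[setI/setT]_(i : I) (proj i @^-1` B i).
  apply/seteqP; split => f /=.
    by move=> h; elim/big_ind: _ => [//|A C Af Cf|i _]; [split|exact: h].
  by move=> h i; move: h; rewrite (bigD1 i)//= => -[].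
apply: big_ind; [exact: clopenT|by move=> A C; exact: clopenI|].
by move=> i _; apply: preimage_clopen (cB i) _; exact: proj_continuous.
Qed.

(** At infinity, closedness holds because complements of closed compact sets are neighbourhoods of
    infinity. *)
Lemma opc_clopen_some (T : topologicalType) (K : set T) :
  compact K -> clopen K -> clopen (Some @` K : set (one_point_compactification T)).
Proof.
move=> cK [oK clK]; split; first exact: one_point_compactification_open_some.
rewrite -openC openE => -[x|_] /=.
  move=> Kx; have h : nbhs x (~` K).
    apply: open_nbhs_nbhs; split; first by rewrite openC.
    by move=> Kx'; apply: Kx; exists x.
  apply: filterS (one_point_compactification_some_nbhs _ _ h) => y [y' Ky' <-].
  by move=> [z Kz [zy]]; apply: Ky'; rewrite -zy.
exists K; first by split.
by move=> y [[y' Ky' <-]|->] [z Kz] // [zy]; apply: Ky'; rewrite -zy.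
Qed.

Lemma clopen_discrete (T : discreteTopologicalType) (A : set T) : clopen A.
Proof. by split; [exact: discrete_open|exact: discrete_closed]. Qed.

(** Open sets of the initial topology are preimages, so a point of [K] above a cluster point of the
    image filter is itself a cluster point. *)
Lemma compact_initial (S : choiceType) (T : topologicalType) (f : S -> T)
  (K : set (initial_topology f)) : compact (f @` K) -> compact K.
Proof.
move=> cK F FF FK.
have [|y [[a Ka <-{y}] ay]] := cK (f @ F) (fmap_proper_filter f FF).
  by apply: (@filterS _ F _ K) FK; exact: preimage_image.
exists a; split => // P Q FP [_ [[V oV <-] Va VQ]].
have : (f @ F) (f @` P) by apply: (@filterS _ F _ P) FP; exact: preimage_image.
move=> /ay/(_ (open_nbhs_nbhs (conj oV Va))) [_ [[b Pb <-] Vb]].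
by exists b; split => //; exact: VQ.
Qed.

Section Slice.
Variable n : nat.
Implicit Types (W : set ('I_n -> option nat)) (x : 'I_n -> int).

Definition wspace := {ptws 'I_n -> one_point_compactification nat}.

Definition slice (z : int) x W : set (Ftilde n) :=
  [set a | [/\ Fz a = z, Fx a = x & W (Fsrc a)]].

Lemma slice_clopen z x W : clopen (W : set wspace) -> clopen (slice z x W).
Proof.
move=> cW.
have -> : slice z x W = (val : Ftilde n -> triple n) @^-1`
    ((fst \o fst) @^-1` [set z] `&`
     (snd \o fst) @^-1` [set f : {ptws 'I_n -> discrete_topology int} | forall i, [set x i] (f i)] `&`
     snd @^-1` (W : set wspace)).
  apply/seteqP; split => a /=; first by case=> <- <- ?.
  by case=> -[<- h] ?; split => //; apply/funext.
have c1 : continuous (fst : triple n -> _) by move=> t; exact: cvg_fst.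
have c2 : continuous (snd : triple n -> _) by move=> t; exact: cvg_snd.
apply: preimage_clopen; last exact: initial_continuous.
apply: clopenI; first apply: clopenI.
- apply: (preimage_clopen (clopen_discrete [set z : discrete_topology int])) => t.
  by apply: continuous_comp (c1 t) _; exact: cvg_fst.
- apply: (@preimage_clopen _ {ptws 'I_n -> discrete_topology int}).
    exact: (@clopen_cylinder 'I_n (fun=> discrete_topology int) (fun i => [set x i])
      (fun=> clopen_discrete _)).
  by move=> t; apply: continuous_comp (c1 t) _; exact: cvg_snd.
- exact: preimage_clopen cW c2.
Qed.

(** Admissibility of all of [W] makes the slice a copy of [W], a closed subset of a space compact by
    Tychonoff. *)
Lemma slice_compact z x W : closed (W : set wspace) ->
  (forall w, W w -> in_Ftilde ((z, x, w) : triple n)) -> compact (slice z x W).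
Proof.
move=> cW admW.
have cW' : compact (W : set wspace).
  apply: (@subclosed_compact wspace _ [set f | forall i, setT (f i)] cW) => //.
  apply: (@tychonoff 'I_n (fun=> one_point_compactification nat) (fun=> setT)) => i.
  exact: one_point_compactification_compact.
apply: compact_initial.
rewrite (_ : _ @` _ = [set (z, x)] `*` W).
  by apply: compact_setX => //; exact: compact_set1.
apply/seteqP; split => [_ [a [<- <- Wa] <-]|[p w] [/= -> Ww]].
  by split => //=; exact: surjective_pairing.
by exists (mkF (admW _ Ww)) => //; split.
Qed.

End Slice.

(** * Convolution of characteristic functions *)

Lemma continuous_clopen (T U : topologicalType) (S : set T) (f : T -> U) :
  clopen S -> (forall a b, S a -> S b -> f a = f b) ->
  (forall a b, ~ S a -> ~ S b -> f a = f b) -> continuous f.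
Proof.
move=> [oS cS] fS fnS a; apply: cvg_near_cst.
have [Sa|Sa] := pselect (S a).
  by apply: filterS (open_nbhs_nbhs (conj oS Sa)) => b Sb; exact: fS.
by apply: filterS (open_nbhs_nbhs (conj (closed_openC cS) Sa)) => b Sb; exact: fnS.
Qed.

Section Convolution.
Variables (R : realType) (n : nat).
Implicit Types (W : set ('I_n -> option nat)) (x : 'I_n -> int) (z : int).
Implicit Types (f g : Fn n -> R[i]) (u : Fn n).

Definition slice_char z x W : Fn n -> R[i] :=
  fun u => `[< exists a : Ftilde n,
    [/\ Fz a = z, Fx a = x, W (Fsrc a) & u = Fcl a] >]%:R.

(** This makes the slice over [W] the full preimage of its image in the quotient. *)
Definition saturated W := forall w w', nrm w = nrm w' -> W w -> W w'.

(** The slice then descends to a compact open set of the quotient groupoid; with [z] and [x] fixed,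
    an element is determined by its source. *)
Definition bisection z x W :=
  [/\ saturated W, clopen (W : set (wspace n))
    & forall w, W w -> in_Ftilde ((z, x, w) : triple n)].

Lemma slice_charE z x W a : saturated W ->
  slice_char z x W (Fcl a) = `[< slice z x W a >]%:R.
Proof.
move=> sW; congr (_%:R); congr nat_of_bool; apply/asboolP/asboolP.
  move=> [b [bz bx Wb /FclP[ez ex /esym/sW h]]].
  by split; [rewrite ez|rewrite ex|exact: h].
by move=> [az ax Wa]; exists a.
Qed.

Lemma slice_char_neq0 z x W u : slice_char z x W u != 0 ->
  exists2 a, slice z x W a & u = Fcl a.
Proof.
rewrite /slice_char; case: asboolP => [[a [? ? ? ->]] _|]; last by rewrite eqxx.
by exists a.
Qed.

Lemma Cc_slice_char z x W : bisection z x W -> Cc (slice_char z x W).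
Proof.
move=> [sW cW aW]; have [oS cS] := slice_clopen z x cW.
have E : [set u | slice_char z x W u != 0] = @Fcl n @` slice z x W.
  apply/seteqP; split => u /=.
    by move=> /slice_char_neq0[a Sa ->]; exists a.
  by move=> [a Sa <-]; rewrite slice_charE// asboolT// oner_eq0.
(* By saturation the image pulls back to the slice itself, so clopenness passes to the quotient
   topology. *)
have piE : \pi_(quotient_topology {eq_quot Fsim_equiv n})%qT @^-1`
    (@Fcl n @` slice z x W) = slice z x W.
  apply/seteqP; split => a /=; last by move=> Sa; exists a.
  move=> [b [bz bx Wb] /FclP[ez ex /sW es]].
  by split; [rewrite -ez|rewrite -ex|exact: es].
split; last first.
  rewrite E -(closure_id _).1.
    apply: continuous_compact; last exact: slice_compact cW.2 aW.
    by apply: continuous_subspaceT; exact: pi_continuous.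
  rewrite -openC; suff : open (\pi_(quotient_topology {eq_quot Fsim_equiv n})%qT
    @^-1` (~` (@Fcl n @` slice z x W))) by [].
  by rewrite -preimage_setC piE openC.
apply/quotient_continuous; apply: (continuous_clopen (conj oS cS)) => a b Sa Sb.
  by rewrite /= [LHS](slice_charE _ _ a)// [RHS](slice_charE _ _ b)// !asboolT.
by rewrite /= [LHS](slice_charE _ _ a)// [RHS](slice_charE _ _ b)// !asboolF.
Qed.

Lemma unit_charE W : unit_char R W = slice_char 0 (fun=> 0) W.
Proof. by []. Qed.

Lemma conv_eq0 f g u :
  (forall v w, Fmul v w u -> f v * g w = 0) -> Defs.conv f g u = 0.
Proof. by move=> h; rewrite /Defs.conv fsbig1// => -[v w] /h. Qed.

Lemma conv_one f g u v0 w0 : Fmul v0 w0 u ->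
  (forall v w, Fmul v w u -> f v * g w != 0 -> (v, w) = (v0, w0)) ->
  Defs.conv f g u = f v0 * g w0.
Proof.
move=> h0 h; rewrite /Defs.conv -(fsbig_widen [set (v0, w0)]) ?fsbig_set1//.
  by move=> _ -> /=.
move=> [v w] [/= /h hvw ne]; apply/eqP; apply: contra_notT ne => /hvw.
by [].
Qed.

(** Up to equivalence, an arrow over [w] factors through the two slices in only one way, as
    [(z1, x1, x2 + w)] times [(z2, x2, w)]. *)
Lemma conv_slice_char z1 x1 W1 z2 x2 W2 :
  bisection z1 x1 W1 -> bisection z2 x2 W2 ->
  Defs.conv (slice_char z1 x1 W1) (slice_char z2 x2 W2) =
  slice_char (z1 + z2) (fun i => x1 i + x2 i) (W2 `&` wshift x2 @^-1` W1).
Proof.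
move=> [s1 _ a1] [s2 _ a2]; apply/funext; apply: Fn_ind => c.
have s12 : saturated (W2 `&` wshift x2 @^-1` W1).
  move=> w w' ww' [/(s2 _ _ ww') ? /= h]; split => //=.
  by apply: s1 h; rewrite !nrm_wshift ww'.
have nz v w : Fmul v w (Fcl c) ->
    slice_char z1 x1 W1 v * slice_char z2 x2 W2 w != 0 ->
  exists a b, [/\ slice z1 x1 W1 a, slice z2 x2 W2 b, v = Fcl a, w = Fcl b &
    [/\ Fz c = z1 + z2, Fx c = (fun i => x1 i + x2 i),
       nrm (Fsrc c) = nrm (Fsrc b) & Fsrc a = wshift x2 (Fsrc b)]].
  move=> [a [b [c' [-> -> /FclP[cz cx cs] [pab pz px ps]]]]].
  rewrite mulf_eq0 negb_or !slice_charE// => /andP[].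
  case: asboolP => [[az ax Wa] _|]; last by rewrite eqxx.
  case: asboolP => [[bz bx Wb] _|]; last by rewrite eqxx.
  exists a, b; split => //; split.
  - by rewrite cz pz az bz.
  - by rewrite cx px ax bx.
  - by rewrite cs ps.
  - by rewrite pab /Ftgt bx.
rewrite slice_charE//; have [[cz cx [Wc Wc']]|Sc] := asboolP (slice _ _ _ c).
  pose b := mkF (a2 _ Wc); pose a := mkF (a1 _ Wc').
  have Sa : slice z1 x1 W1 a by split.
  have Sb : slice z2 x2 W2 b by split.
  rewrite (@conv_one _ _ _ (Fcl a) (Fcl b)).
  - by rewrite !slice_charE// !asboolT// mulr1.
  - by exists a, b, c; split => //; split.
  - move=> v w /nz h /h [a' [b' [[az' ax' _] [bz' bx' _] -> -> [_ _ sb sa]]]].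
    by congr (_, _); apply/FclP; split; rewrite // ?sa ?nrm_wshift -sb -?nrm_wshift.
apply: conv_eq0 => v w /nz h; apply/eqP; apply: contra_notT Sc => /h.
move=> [a [b [[az ax Wa] [bz bx Wb] _ _ [cz cx cs sa]]]]; split => //.
by apply: (s12 (Fsrc b)) => //; split => //=; rewrite -sa.
Qed.

(** The only factorization of [c] with a unit on the left uses the unit at the target of [c]. *)
Lemma conv_unit f : Defs.conv (unit_char R setT) f = f.
Proof.
apply/funext; apply: Fn_ind => c.
have h0 : in_Ftilde ((0, (fun=> 0), Ftgt c) : triple n).
  by split => //= i _; split => //; rewrite big1 ?oppr0 ?subrr.
have sT : saturated setT by [].
have uE (a : Ftilde n) : unit_char R setT (Fcl a) = `[< slice 0 (fun=> 0) setT a >]%:R.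
  by rewrite unit_charE slice_charE.
have Fmul0 : Fmul (Fcl (mkF h0)) (Fcl c) (Fcl c).
  exists (mkF h0), c, c; split => //; split => //; first by rewrite add0r.
  by apply/funext => i; rewrite add0r.
rewrite (conv_one Fmul0) ?uE ?asboolT ?mul1r//.
move=> v w [a [b [c' [-> -> /FclP[cz cx cs] [pab pz px ps]]]]].
rewrite mulf_eq0 negb_or uE => /andP[].
case: asboolP => [[az ax _] _|]; last by rewrite eqxx.
move=> _.
have bz : Fz b = Fz c by rewrite cz pz az add0r.
have bx : Fx b = Fx c.
  by rewrite cx px ax; apply/funext => i; rewrite add0r.
congr (_, _); apply/FclP; split => //; last by rewrite cs ps.
by rewrite pab /Ftgt bx -!/(wshift _ _) !nrm_wshift cs ps.
Qed.

Lemma Cc0 : Cc ((fun=> 0) : Fn n -> R[i]).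
Proof.
split; first exact: cst_continuous.
rewrite (_ : [set _ | _] = set0) ?closure0; first exact: compact0.
by apply/seteqP; split => u //=; rewrite eqxx.
Qed.

Lemma CcD f g : Cc f -> Cc g -> Cc (fun u => f u + g u).
Proof.
move=> [fc fK] [gc gK]; split.
  by move=> u; exact: (@cvgD R[i] R[i]^o _ _ _ f g _ _ (fc u) (gc u)).
apply: (subclosed_compact (@closed_closure _ _) (compactU fK gK)).
rewrite -closureU; apply: closure_subset => u /=.
apply: contra_neqP => /not_orP[/negP/negPn/eqP-> /negP/negPn/eqP->].
by rewrite addr0.
Qed.

End Convolution.

(** * Frames in graded C*-algebras *)

Section CstarNorm.
Variables (R : realType) (A : cstarAlgType R).
Implicit Types a : A.

Lemma cnormN a : cnorm (- a) = cnorm a.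
Proof. by rewrite -scaleN1r cnormZ normrN1 mul1r. Qed.

Lemma cnorm0 : cnorm (0 : A) = 0.
Proof. by rewrite -[X in cnorm X](scale0r (0 : A)) cnormZ normr0 mul0r. Qed.

(** Positivity is not among the norm axioms; the triangle inequality for [a] and [- a] yields it. *)
Lemma cnorm_ge0 a : 0 <= cnorm a.
Proof.
have := cnormD a (- a); rewrite subrr cnorm0 cnormN -mulr2n.
by rewrite pmulrn_lge0.
Qed.

Lemma cnorm_small_eq0 a : (forall e : R, 0 < e -> cnorm a <= e) -> a = 0.
Proof.
move=> h; apply: cnorm_eq0; apply/eqP; rewrite eq_le cnorm_ge0 andbT.
by apply/ler_addgt0Pl => e e0; rewrite addr0; exact: h.
Qed.

End CstarNorm.

Section FrameIso.
Variables (R : realType) (A : cstarAlgType R) (rho : R[i] -> A -> A).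
Hypothesis rhoH : forall t : R[i], `|t| = 1 -> star_hom (rho t).

Lemma spectral0 k : spectral rho k 0.
Proof.
move=> t t1; have [h _ _] := rhoH t1.
by have := h (-1) 0 0; rewrite scaler0 addr0 scaleN1r addNr scaler0.
Qed.

Lemma spectralD k a b : spectral rho k a -> spectral rho k b -> spectral rho k (a + b).
Proof.
move=> ha hb t t1; have [h _ _] := rhoH t1.
by have := h 1 a b; rewrite !scale1r => ->; rewrite ha// hb// scalerDr.
Qed.

Lemma spectral_sum k (I : Type) (r : seq I) (F : I -> A) :
  (forall i, spectral rho k (F i)) -> spectral rho k (\sum_(i <- r) F i).
Proof.
by move=> h; elim/big_ind: _ => [|a b|i _//]; [exact: spectral0|exact: spectralD].
Qed.

Lemma spectralM k l a b : spectral rho k a -> spectral rho l b ->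
  spectral rho (k + l) (a * b).
Proof.
move=> ha hb t t1; have [_ h _] := rhoH t1.
rewrite h ha// hb// -scalerAl -scalerAr scalerA -expfzDr//.
by rewrite -normr_eq0 t1 oner_eq0.
Qed.

(* The inverse of a |-> (a v_p)_p is c |-> \sum_p c_p u_p. *)
Lemma frame_left_module_iso (k : int) (N : nat) (u v : 'I_N -> A) :
  (forall p, spectral rho k (u p)) -> (forall p, spectral rho (- k) (v p)) ->
  \sum_p v p * u p = 1 ->
  left_module_iso (spectral rho 0) (spectral rho k)
    (proj_module (spectral rho 0) (\matrix_(p, q) (u p * v q))).
Proof.
move=> hu hv vu1; set M := \matrix_(p, q) _.
have decomp a : \sum_p a * v p * u p = a.
  by under eq_bigr do rewrite -mulrA; rewrite -mulr_sumr vu1 mulr1.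
(* The sum of the [v r * u r] appears in the middle and equals 1. *)
have MM : M *m M = M.
  apply/matrixP => p q; rewrite !mxE.
  under eq_bigr do rewrite !mxE mulrA -[u p * _ * _]mulrA -mulrA.
  rewrite -[RHS](_ : u p * (\sum_r v r * u r) * v q = _); last by rewrite vu1 mulr1.
  rewrite mulr_sumr mulr_suml; apply: eq_bigr => r _.
  by rewrite !mulrA.
exists (fun a => \row_p (a * v p)); last split.
- split.
  + move=> a La; exists (\row_p (a * v p)) => [p|].
      by rewrite mxE -(subrr k); exact: spectralM.
    apply/rowP => q; rewrite !mxE -[in LHS](decomp a) mulr_suml.
    by apply: eq_bigr => p _; rewrite !mxE mulrA.
  + move=> a b _ _ ab; rewrite -(decomp a) -(decomp b).
    by apply: eq_bigr => p _; move/rowP/(_ p): ab; rewrite !mxE => ->.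
  (* The preimage uses the entries of [c *m M], which have degree 0; idempotence of [M] then gives
     back [c *m M]. *)
  + move=> _ [c hc ->]; exists (\sum_p (c *m M) 0 p * u p).
      apply: spectral_sum => p; rewrite -[k]add0r; apply: spectralM => //.
      rewrite mxE; apply: spectral_sum => q; rewrite mxE -[0]add0r.
      by apply: spectralM => //; rewrite -(subrr k); exact: spectralM.
    apply/rowP => q; rewrite mxE mulr_suml -[in RHS]MM mulmxA [RHS]mxE.
    by apply: eq_bigr => p _; rewrite [M p q]mxE mulrA.
- by move=> a b _ _; apply/rowP => p; rewrite !mxE mulrDl.
- by move=> s a _ _; apply/rowP => p; rewrite !mxE mulrA.
Qed.

End FrameIso.

(** * The canonical map from [Cc] to the groupoid algebra *)

Section Iota.
Variables (R : realType) (n : nat) (A : cstarAlgType R).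
Variable iota : (Fn n -> R[i]) -> A.
Hypothesis iotaH : is_groupoid_cstar iota.

Lemma iotaL (c : R[i]) f g : Cc f -> Cc g ->
  iota (fun u => c * f u + g u) = c *: iota f + iota g.
Proof. by have [[h _ _] _ _] := iotaH; exact: h. Qed.

Lemma iotaM f g : Cc f -> Cc g -> iota (Defs.conv f g) = iota f * iota g.
Proof. by have [[_ h _] _ _] := iotaH; exact: h. Qed.

Lemma iotaD f g : Cc f -> Cc g -> iota (fun u => f u + g u) = iota f + iota g.
Proof.
move=> hf hg; rewrite -[iota f]scale1r -iotaL//; congr iota.
by apply/funext => u; rewrite mul1r.
Qed.

Lemma iota0 : iota (fun=> 0) = 0.
Proof.
have := iotaD (@Cc0 R n) (@Cc0 R n).
under [X in iota X]eq_fun do rewrite addr0.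
by move/eqP; rewrite -subr_eq0 opprD addrA subrr add0r oppr_eq0 => /eqP.
Qed.

Lemma iotaZ (c : R[i]) f : Cc f -> iota (fun u => c * f u) = c *: iota f.
Proof.
move=> hf; rewrite -[RHS]addr0 -iota0 -iotaL//; last exact: Cc0.
by congr iota; apply/funext => u; rewrite addr0.
Qed.

Lemma iota_sum (I : Type) (r : seq I) (F : I -> Fn n -> R[i]) :
  (forall i, Cc (F i)) ->
  iota (fun u => \sum_(i <- r) F i u) = \sum_(i <- r) iota (F i).
Proof.
move=> h; suff [] : Cc (fun u => \sum_(i <- r) F i u) /\
    iota (fun u => \sum_(i <- r) F i u) = \sum_(i <- r) iota (F i) by [].
elim: r => [|i r [ih1 ih2]].
  rewrite big_nil; under [fun u => \sum_(i <- _) _]eq_fun do rewrite big_nil.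
  by split; [exact: Cc0|exact: iota0].
rewrite big_cons; under [fun u => \sum_(i <- _) _]eq_fun do rewrite big_cons.
by rewrite -ih2; split; [exact: CcD|exact: iotaD].
Qed.

(** Preservation of units is not part of [Cc_star_hom]. Instead, [e] is a left identity on the dense
    image of [iota], hence on all of [A] by a norm estimate, and so [e = e * 1 = 1]. *)
Lemma iota_unit : Cc (unit_char R (@setT ('I_n -> option nat))) ->
  iota (unit_char R setT) = 1.
Proof.
move=> hT; set e := iota _.
suff ea a : e * a = a by rewrite -[e]mulr1 ea.
apply/eqP; rewrite -subr_eq0; apply/eqP; apply: cnorm_small_eq0 => d d0.
have c0 : 0 < cnorm e + 1 by rewrite ltr_wpDl// cnorm_ge0.
have [_ dense _] := iotaH.
(* The tolerance absorbs the factor in [cnorm (e * b - b) <= (cnorm e + 1) * cnorm b], used with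
   [b = a - iota f]. *)
have [f hf af] := dense a (d / (cnorm e + 1)) (divr_gt0 d0 c0).
have ef : e * iota f = iota f by rewrite -iotaM// conv_unit.
rewrite (_ : e * a - a = e * (a - iota f) - (a - iota f)); last first.
  by rewrite mulrBr ef opprB addrA subrK.
apply: (le_trans (cnormD _ _)); rewrite cnormN.
apply: (@le_trans _ _ ((cnorm e + 1) * cnorm (a - iota f))).
  by rewrite mulrDl mul1r lerD2r cnormM.
by rewrite mulrC -ler_pdivlMr// ltW.
Qed.

Variable rho : R[i] -> A -> A.
Hypothesis gaugeH : is_gauge_action iota rho.

Lemma spectral_iota k f : Cc f -> (forall u, f u != 0 -> Fdeg u = k) ->
  spectral rho k (iota f).
Proof.
move=> hf hk t t1; have [_ _ _ h] := gaugeH.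
rewrite h// -iotaZ//; congr iota; apply/funext => u.
by have [->|/hk ->//] := eqVneq (f u) 0; rewrite !mulr0.
Qed.

End Iota.

(** * Box-shaped bisections *)

Section Boxes.
Variable n : nat.
Implicit Types (F : 'I_n -> bool) (lo s r : 'I_n -> nat) (w : 'I_n -> option nat).

(** [F] marks the coordinates pinned to one finite value; each other one ranges over a neighbourhood
    of infinity. *)
Definition box F lo : set ('I_n -> option nat) :=
  [set w | forall i, if F i then w i = Some (lo i)
                     else forall p, w i = Some p -> (lo i <= p)%N].

(** The pinned coordinates form an initial segment and only the first free one may have a positive
    bound. Nothing is then demanded after an infinite coordinate, as saturation requires. *)
Definition tail_free F lo := forall i j : 'I_n,
  ~~ F i -> (i < j)%N -> ~~ F j /\ lo j = 0%N.

Lemma box_infinite F lo w i : box F lo w -> w i = None -> ~~ F i.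
Proof. by move=> /(_ i); case: ifP => // _ ->. Qed.

Lemma box_finite F lo w i p : box F lo w -> w i = Some p -> (lo i <= p)%N.
Proof. by move=> /(_ i); case: ifP => [_ -> [->]|_]; [|exact]. Qed.

Lemma clopen_box F lo : clopen (box F lo : set (wspace n)).
Proof.
have cK (K : set nat) : finite_set K ->
    clopen (Some @` K : set (one_point_compactification nat)).
  by move=> fK; apply: opc_clopen_some; [exact: finite_compact|exact: clopen_discrete].
pose B i : set (one_point_compactification nat) :=
  if F i then Some @` [set lo i] else ~` (Some @` `I_(lo i)).
have -> : box F lo = [set w : wspace n | forall i, B i (w i)].
  apply/seteqP; split => w /= h i; have := h i; rewrite /B.
    case: ifP => [_ ->|_ {}h [p /= pl ps]]; first by exists (lo i).
    by have := h p (esym ps); rewrite leqNgt pl.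
  case: ifP => [_ [p -> <-]//|_ {}h p wp].
  by rewrite leqNgt; apply/negP => pl; apply: h; exists p.
apply: (@clopen_cylinder 'I_n (fun=> one_point_compactification nat)) => i.
rewrite /B; case: ifP => _; first exact: cK.
by have [? ?] := cK _ (finite_II (lo i)); split; [exact: closed_openC|exact: open_closedC].
Qed.

Lemma saturated_box F lo : tail_free F lo -> saturated (box F lo).
Proof.
move=> tF w w' ww' bw i.
case E : (nrm w' i) => [p|].
  rewrite (nrm_some E); have := bw i.
  by rewrite -ww' in E; rewrite (nrm_some E).
have [j ji w'j] := nrm_eq_None E.
have : nrm w j = None by rewrite ww'; exact: nrm_None w'j.
(* The infinite coordinate [l] of [w] is free and at most [i]: either it is [i], where [w'] is
   infinite too, or tail freeness removes every constraint at [i]. *)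
move=> /nrm_eq_None[l lj /(box_infinite bw) Fl].
have := leq_trans lj ji; rewrite leq_eqVlt => /orP[/eqP/val_inj li|li].
  have ij : i = j by apply/val_inj/eqP; rewrite eqn_leq ji -li lj.
  by rewrite -li (negbTE Fl) li ij w'j.
by have [/negbTE -> ->] := tF _ _ Fl li.
Qed.

(* For w in [box F s], (z, r - s, w) is an arrow, with target in [box F r]. *)
Definition box_shift (z : int) F s r := [/\ tail_free F s, tail_free F r &
  forall i, ~~ F i -> (r i)%:Z - (s i)%:Z =
    - z - \sum_(j < n | (j < i)%N) ((r j)%:Z - (s j)%:Z)].

Lemma box_shiftC z F s r : box_shift z F s r -> box_shift (- z) F r s.
Proof.
move=> [ts tr h]; split => // i Fi; rewrite -opprB h// opprB addrC opprK; congr (_ + _).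
by rewrite -sumrN; apply: eq_bigr => j _; rewrite opprB.
Qed.

(** Infinite coordinates of a box point are free; there [box_shift] is the defining condition of the
    groupoid, and later displacements vanish since both bounds are 0. *)
Lemma bisection_box_shift z F s r : box_shift z F s r ->
  bisection z (fun i => (r i)%:Z - (s i)%:Z) (box F s).
Proof.
move=> [ts tr h]; split; [exact: saturated_box|exact: clopen_box|].
move=> w bw; split => /= [i m wi|i /(box_infinite bw) Fi].
  have := box_finite bw wi; rewrite -lez_nat => sm.
  by rewrite -addrA addr_ge0// addrC subr_ge0.
split => [|j ij]; first exact: h.
by have [_ ->] := ts _ _ Fi ij; have [_ ->] := tr _ _ Fi ij.
Qed.

(** For a bisection and its inverse, this collapses the intersection in [conv_slice_char] to one
    box. *)
Lemma wshift_box F s r w : box F s w ->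
  box F r (wshift (fun i => (r i)%:Z - (s i)%:Z) w).
Proof.
move=> bw i; have := bw i; rewrite /wshift; case: ifP => [_ -> /=|_].
  by rewrite subrK.
case: (w i) => [m|] //= /(_ _ erefl) sm p [<-].
rewrite -lez_nat gez0_abs; first by rewrite -addrA lerDl addrC subr_ge0 lez_nat.
by rewrite -addrA addr_ge0// addrC subr_ge0 lez_nat.
Qed.

Lemma bisection_unit_box F lo : tail_free F lo -> bisection 0 (fun=> 0) (box F lo).
Proof.
move=> tF; split; [exact: saturated_box|exact: clopen_box|].
by move=> w _; split => //= i _; split => //; rewrite big1 ?oppr0 ?subrr.
Qed.

End Boxes.

(** * Operators represented by indicators of boxes *)

Section Represents.
Variables (R : realType) (n : nat).
Implicit Types (F : 'I_n -> bool) (lo : 'I_n -> nat).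

Lemma pi_n_unit_char (W : set ('I_n -> option nat)) : saturated W ->
  pi_n (unit_char R W) =
  fun w v => `[< w = v /\ W (fun i => Some (w i)) >]%:R.
Proof.
move=> sW; apply/funext => w; apply/funext => v; rewrite /pi_n.
(* [(0, v - w, w)] is the only arrow of degree 0 from [w] to [v]. *)
have h0 : in_Ftilde ((0, (fun i => (v i)%:Z - (w i)%:Z), (fun i => Some (w i))) : triple n).
  by split => //= i m [<-]; rewrite subrK.
rewrite (_ : [set a | _] = [set mkF h0]).
  rewrite fsbig_set1 unit_charE slice_charE//; congr (_%:R); congr nat_of_bool.
  apply/asboolP/asboolP => [[_ x0 Ww]|[vw Ww]].
    split => //; apply/funext => i; have /= := congr1 (fun f => f i) x0.
    by rewrite /Fx/= => /eqP; rewrite subr_eq0 => /eqP[].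
  by split => //; apply/funext => i; rewrite /Fx/= vw subrr.
apply/seteqP; split => [a [az aw av]|_ ->]; last first.
  by split => //; apply/funext => i; rewrite /Ftgt/= /Fx/= subrK.
apply: Ftilde_eq => //; apply/funext => i; rewrite [RHS]/Fx/=.
have := congr1 (fun f => f i) av; rewrite /Ftgt aw /= => -[<-].
have [+ _] := in_FtildeP a.
by rewrite /= aw => /(_ i _ erefl) h; rewrite gez0_abs// addrK.
Qed.

Lemma prodr_nat_bool (I : finType) (b : I -> bool) :
  \prod_i (b i)%:R = [forall i, b i]%:R :> R[i].
Proof.
case: forallP => [h|/forallP/forallPn[i /negbTE bi]].
  by rewrite big1// => i _; rewrite h.
by rewrite (bigD1 i)//= bi mul0r.
Qed.

Lemma represents_unit_box F lo : tail_free F lo ->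
  represents (unit_char R (box F lo)) (tensor (fun i w v =>
    ((w == v) && (if F i then w == lo i else (lo i <= w)%N))%:R)).
Proof.
move=> tF; split.
- exact: (Cc_slice_char R (bisection_unit_box tF)).
- by move=> u /slice_char_neq0[a [az _ _] ->]; rewrite Fdeg_Fcl.
rewrite pi_n_unit_char; last exact: saturated_box.
apply/funext => w; apply/funext => v; rewrite /tensor prodr_nat_bool.
congr (_%:R); congr nat_of_bool; apply/asboolP/forallP => [[<- bw] i|h].
  by rewrite eqxx; have := bw i; case: ifP => _ /=; [move=> -[->]|exact].
split; first by apply/funext => i; have /andP[/eqP] := h i.
move=> i; have /andP[_] := h i; case: ifP => _; first by move/eqP => ->.
by move=> lw p [<-].
Qed.

Lemma line_charE m : line_char R m =
  unit_char R (box (fun=> false) (fun i : 'I_n => if i == 0%N :> nat then m else 0%N)).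
Proof.
congr unit_char; apply/seteqP; split => w /= h i.
  by move=> p wp; case: ifP => // /eqP i0; exact: h wp.
by move=> i0 p /h; rewrite i0.
Qed.

Lemma corner_charE j : corner_char R j =
  unit_char R (box (fun i : 'I_n => (i < j)%N) (fun=> 0%N)).
Proof.
congr unit_char; apply/seteqP; split => w /= h i; first by case: ifP => // /h.
by move=> ij; have := h i; rewrite ij.
Qed.

Lemma represents_line m : represents (line_char R m) (@line_proj R n m).
Proof.
rewrite line_charE (_ : @line_proj R n m = tensor (fun i w v =>
    ((w == v) && ((if i == 0%N :> nat then m else 0) <= w)%N)%:R)).
  apply: (represents_unit_box (F := fun=> false)) => i j _ ij.
  by split => //; case: eqP => // j0; rewrite j0 in ij.
congr tensor; apply/funext => i; apply: (@funext nat (nat -> R[i])) => w.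
apply: (@funext nat R[i]) => v.
case: ifP => _; last by rewrite leq0n andbT.
rewrite /Pneg /idop /Pproj; case: eqP => _ /=; last by rewrite subrr.
by case: (ltnP w m) => _; rewrite ?subrr ?subr0.
Qed.

Lemma represents_corner j : represents (corner_char R j) (@corner_proj R n j).
Proof.
rewrite corner_charE (_ : @corner_proj R n j = tensor (fun i w v =>
    ((w == v) && (if (i < j)%N then w == 0%N else (0 <= w)%N))%:R)).
  apply: (represents_unit_box (F := fun i : 'I_n => (i < j)%N)) => i l.
  by rewrite -!leqNgt => ji il; rewrite (leq_trans ji (ltnW il)).
congr tensor; apply/funext => i; apply: (@funext nat (nat -> R[i])) => w.
apply: (@funext nat R[i]) => v.
by case: ifP => _; rewrite ?andbT// /Pproj ltnS leqn0.
Qed.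

End Represents.

(** * Modules from partitions of the unit space into boxes *)

Section BoxFrame.
Variables (R : realType) (n : nat) (A : cstarAlgType R).
Variables (iota : (Fn n -> R[i]) -> A) (rho : R[i] -> A -> A).
Hypotheses (iotaH : is_groupoid_cstar iota) (gaugeH : is_gauge_action iota rho).

(** The frame consists of the indicators [v p] of the bisections and [u p] of their inverses:
    [v p * u p] is the indicator of the units over a target box, and these sum to 1. *)
Lemma box_frame_left_module_iso (k : int) (N : nat)
    (F : 'I_N -> 'I_n -> bool) (s r : 'I_N -> 'I_n -> nat) :
  (forall p, box_shift (- k) (F p) (s p) (r p)) ->
  (forall w, exists p, box (F p) (r p) w) ->
  (forall p q w, box (F p) (r p) w -> box (F q) (r q) w -> p = q) ->
  left_module_iso (spectral rho 0) (spectral rho k)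
    (proj_module (spectral rho 0)
      (\matrix_(p, q) (iota (unit_char R (box (F p) (s p))) *+ (p == q)))).
Proof.
move=> hs hex huniq.
pose x p i := (r p i)%:Z - (s p i)%:Z.
pose y p i := (s p i)%:Z - (r p i)%:Z.
have hv p : bisection (- k) (x p) (box (F p) (s p)) by exact: bisection_box_shift.
have hu p : bisection k (y p) (box (F p) (r p)).
  by rewrite -[k]opprK; apply/bisection_box_shift/box_shiftC.
pose v p := iota (slice_char R (- k) (x p) (box (F p) (s p))).
pose u p := iota (slice_char R k (y p) (box (F p) (r p))).
have vuE p : v p * u p = iota (unit_char R (box (F p) (r p))).
  rewrite -iotaM ?conv_slice_char//; [|exact: Cc_slice_char..].
  rewrite addNr unit_charE; congr iota; congr slice_char.
    by apply/funext => i; rewrite /x /y subrKA subrr.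
  by apply/setIidl => w; exact: wshift_box.
have uvE p q : u p * v q = iota (unit_char R (box (F p) (s p))) *+ (p == q).
  rewrite -iotaM ?conv_slice_char//; [|exact: Cc_slice_char..].
  rewrite subrr; have [<-|pq] := eqVneq p q.
    rewrite unit_charE mulr1n; congr iota; congr slice_char.
      by apply/funext => i; rewrite /x /y subrKA subrr.
    by apply/setIidl => w; exact: wshift_box.
  (* For distinct indices, the middle unit of a nonzero product would lie in both target boxes. *)
  rewrite mulr0n -(iota0 iotaH); congr iota.
  apply/funext => c; apply/eqP/contraT => /slice_char_neq0[a [_ _ [aq ap]] _].
  by move: pq; rewrite (huniq p q _ ap (wshift_box _ aq)) eqxx.
have [rhoH _ _ _] := gaugeH.
rewrite (_ : \matrix_(p, q) _ = \matrix_(p, q) (u p * v q)); last first.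
  by apply/matrixP => p q; rewrite !mxE uvE.
have deg z x0 W c : slice_char R z x0 W c != 0 -> Fdeg c = z.
  by move=> /slice_char_neq0[a [<- _ _] ->]; rewrite Fdeg_Fcl.
apply: frame_left_module_iso => //.
- by move=> p; apply: (spectral_iota iotaH gaugeH) => [|c /deg//]; exact: Cc_slice_char.
- by move=> p; apply: (spectral_iota iotaH gaugeH) => [|c /deg//]; exact: Cc_slice_char.
under eq_bigr do rewrite vuE.
have ur p : Cc (unit_char R (box (F p) (r p))).
  apply: (Cc_slice_char R (bisection_unit_box _)).
  by have [] := hs p.
have unitE : unit_char R setT = fun c => \sum_p unit_char R (box (F p) (r p)) c.
  apply/funext; apply: Fn_ind => a.
  have uE W : saturated W -> unit_char R W (Fcl a) = `[< slice 0 (fun=> 0) W a >]%:R.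
    by move=> sW; rewrite unit_charE slice_charE.
  have [p hp] := hex (Fsrc a).
  rewrite (bigD1 p)//= big1 ?addr0 => [|q qp]; rewrite !uE//.
  - congr (_%:R); congr nat_of_bool.
    by apply/asboolP/asboolP => -[? ? _]; split.
  - by have [t _ _] := hu p.
  - rewrite asboolF// => -[_ _ hq].
    by move: qp; rewrite (huniq q p _ hq hp) eqxx.
  - by have [t _ _] := hu q.
rewrite -(iota_sum iotaH)// -unitE iota_unit// unitE.
suff : Cc (fun c => \sum_(p <- index_enum 'I_N) unit_char R (box (F p) (r p)) c) by [].
elim: (index_enum _) => [|p l ih].
  by under eq_fun do rewrite big_nil; exact: Cc0.
by under eq_fun do rewrite big_cons; exact: CcD.
Qed.

End BoxFrame.

(** * Pieces indexed by sequences of bounded sum *)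

Lemma sum_nth_sumn (s : seq nat) m : (size s <= m)%N ->
  (\sum_(l < m) nth 0 s l)%N = sumn s.
Proof.
elim: s m => [|a s ih] m; first by move=> _; rewrite big1// => i _; rewrite nth_nil.
by case: m => // m sm; rewrite big_ord_recl /= ih.
Qed.

(** An index of the block matrix encodes a block and a position in it; the diagonal entry depends on
    the block alone. *)
Lemma mxdiag_scalar (V : nmodType) (m : nat) (p_ : 'I_m -> nat) (c : 'I_m -> V) :
  \mxdiag_(j < m) (\matrix_(s, t) (c j *+ (s == t)) : 'M[V]_(p_ j)) =
  \matrix_(s, t) (c (tagnat.sig1 s) *+ (s == t)).
Proof.
apply/matrixP => s t; rewrite !mxE -(can_eq tagnat.sigK) /tagnat.sig1 /tagnat.sig2.
case: (tagnat.sig s) (tagnat.sig t) => [/= i j] [/= i' j'].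
case: eqP => [<-|ni] in j' *; last by rewrite !mxE; case: eqVneq => // -[].
by rewrite conform_mx_id eq_Tagged/= mxE.
Qed.

Section Compositions.
Variables (n K : nat).
Implicit Types (c : seq nat) (w : 'I_n -> option nat).

(** Stars and bars: with [k = K.+1], the binomial multiplicity counts the sequences of length [j]
    and sum at most [K]. *)
Fact card_bounded_seq j :
  'C(K.+1 + j - 1, j) = #|[set t : j.-tuple 'I_K.+1 | (\sum_(i <- t) i <= K)%N]%SET|.
Proof. by rewrite card_partial_ord_partitions addSn subn1 addnC. Qed.

Definition bounded_seq j (i : 'I_('C(K.+1 + j - 1, j))) : seq nat :=
  map val (enum_val (cast_ord (card_bounded_seq j) i) : j.-tuple 'I_K.+1).

Lemma size_bounded_seq j (i : 'I_('C(K.+1 + j - 1, j))) : size (bounded_seq i) = j.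
Proof. by rewrite size_map size_tuple. Qed.

Lemma sumn_bounded_seq j (i : 'I_('C(K.+1 + j - 1, j))) : (sumn (bounded_seq i) <= K)%N.
Proof.
rewrite sumnE big_map; have := enum_valP (cast_ord (card_bounded_seq j) i).
by rewrite inE.
Qed.

Lemma bounded_seq_inj j : injective (@bounded_seq j).
Proof.
move=> i i' /(inj_map val_inj)/val_inj/enum_val_inj; exact: cast_ord_inj.
Qed.

Lemma bounded_seq_surj c : (sumn c <= K)%N ->
  exists i : 'I_('C(K.+1 + size c - 1, size c)), bounded_seq i = c.
Proof.
(* Each entry is at most the sum, hence at most [K], so [inord] alters nothing. *)
move=> cK; have cb l : l \in c -> (l < K.+1)%N.
  move=> lc; rewrite ltnS (leq_trans _ cK)// sumnE (big_rem l)//=; exact: leq_addr.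
have sz : size (map (inord : nat -> 'I_K.+1) c) == size c by rewrite size_map.
have E : map val (Tuple sz) = c.
  by rewrite /= -map_comp -[RHS]map_id; apply/eq_in_map => l /cb lK /=; rewrite inordK.
have tP : Tuple sz \in [set t : (size c).-tuple 'I_K.+1 | (\sum_(i <- t) i <= K)%N]%SET.
  by rewrite inE -(big_map val predT id) E -sumnE.
exists (cast_ord (esym (card_bounded_seq _)) (enum_rank_in tP (Tuple sz))).
by rewrite /bounded_seq cast_ordKV enum_rankK_in.
Qed.

(* With k = K.+1, these are the entries of the vector (c, k - sumn c, 0, ..., 0). *)
Definition target_lo c : nat -> nat := nth 0%N (rcons c (K.+1 - sumn c)%N).

Let F c (i : 'I_n) := (i < size c)%N.

Lemma target_lo_gt c i : (size c < i)%N -> target_lo c i = 0%N.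
Proof. by move=> ci; rewrite /target_lo nth_default// size_rcons. Qed.

Lemma box_shift_target c : (sumn c <= K)%N ->
  box_shift (- K.+1%:Z) (F c) (fun=> 0%N) (fun i => target_lo c i).
Proof.
move=> cK; split => [i j|i j|i]; rewrite /F -leqNgt => ci.
- by move=> ij; rewrite -leqNgt (leq_trans ci (ltnW ij)).
- move=> ij; rewrite -leqNgt (leq_trans ci (ltnW ij)) target_lo_gt//.
  exact: leq_ltn_trans ij.
under eq_bigr do rewrite subr0.
rewrite subr0 opprK; apply/eqP; rewrite eq_sym subr_eq addrC; apply/eqP.
rewrite -(big_ord_widen n (fun l => (target_lo c l)%:Z) (ltnW (ltn_ord i))).
(* Since [size c <= i], the first [i.+1] entries contain all of [c] and the complement
   [K.+1 - sumn c]. *)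
transitivity ((\sum_(l < i.+1) target_lo c l)%N%:Z).
  by rewrite sum_nth_sumn ?size_rcons// sumn_rcons subnKC// leqW.
rewrite big_ord_recr/= PoszD -[in LHS]natz natr_sum; congr (_ + _).
by apply: eq_bigr => l _; rewrite natz.
Qed.

(** Both sequences are read off [w], so one is a prefix of the other. Were it a proper prefix [c] of
    [c'], the next coordinate would be at least [K.+1 - sumn c], pushing [sumn c'] past [K]. *)
Lemma box_target_inj c c' w : (size c <= n)%N -> (size c' <= n)%N ->
  (sumn c <= K)%N -> (sumn c' <= K)%N ->
  box (F c) (fun i => target_lo c i) w -> box (F c') (fun i => target_lo c' i) w ->
  c = c'.
Proof.
wlog cc' : c c' / (size c <= size c')%N.
  by move=> h *; case: (leqP (size c) (size c')) => [|/ltnW] le; [|symmetry]; exact: h.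
move=> cn c'n cK c'K bc bc'.
have wE d (i : 'I_n) : box (F d) (fun i => target_lo d i) w -> (i < size d)%N ->
    w i = Some (nth 0%N d i).
  by move=> /(_ i) + id; rewrite /F id /target_lo nth_rcons id.
have nE l : (l < size c)%N -> nth 0%N c l = nth 0%N c' l.
  move=> lc; have ln := leq_trans lc cn.
  by have := wE _ (Ordinal ln) bc lc; rewrite (wE _ (Ordinal ln) bc' (leq_trans lc cc')) => -[].
have cE : c = take (size c) c'.
  apply: (@eq_from_nth _ 0%N); first by rewrite size_takel.
  by move=> l lc; rewrite nth_take// nE.
move: cc'; rewrite leq_eqVlt => /orP[/eqP ss|ss]; first by rewrite cE ss take_size.
have i0n := leq_trans ss c'n.
have := bc (Ordinal i0n); rewrite /F ltnn (wE _ (Ordinal i0n) bc' ss) => /(_ _ erefl).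
rewrite /target_lo nth_rcons ltnn eqxx leq_subLR => h.
have : (sumn (take (size c).+1 c') <= sumn c')%N.
  by rewrite -[in leqRHS](cat_take_drop (size c).+1 c') sumn_cat leq_addr.
rewrite (take_nth 0%N)// sumn_rcons -cE => /(leq_trans h)/leq_trans/(_ c'K).
by rewrite ltnn.
Qed.

(** Coordinates are read until one is infinite or would make the sum exceed [K], or until all [n]
    are read. *)
Lemma box_target_cover w : exists c, [/\ (size c <= n)%N, (sumn c <= K)%N &
  box (F c) (fun i => target_lo c i) w].
Proof.
have boxI c : (forall i : 'I_n, (i < size c)%N -> w i = Some (nth 0%N c i)) ->
    (forall i : 'I_n, i = size c :> nat -> forall p, w i = Some p ->
      (K.+1 - sumn c <= p)%N) ->
    box (F c) (fun i => target_lo c i) w.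
  move=> h1 h2 i; rewrite /F; case: ltnP => ci.
    by rewrite h1// /target_lo nth_rcons ci.
  move=> p wp; move: ci; rewrite leq_eqVlt => /orP[/eqP ci|/target_lo_gt->//].
  by rewrite /target_lo -ci nth_rcons ltnn eqxx; exact: h2 wp.
(* Invariant: either a box is found, or the first [m] coordinates are finite with sum at most
   [K]. *)
suff /(_ n (leqnn n))[//|[c [cn cK h]]] : forall m, (m <= n)%N ->
    (exists c, [/\ (size c <= n)%N, (sumn c <= K)%N &
       box (F c) (fun i => target_lo c i) w]) \/
    (exists c, [/\ size c = m, (sumn c <= K)%N &
       forall i : 'I_n, (i < size c)%N -> w i = Some (nth 0%N c i)]).
  exists c; split; rewrite ?cn//; apply: boxI => // i ic.
  by have := ltn_ord i; rewrite ic cn ltnn.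
elim=> [_|m ih mn]; first by right; exists [::].
have [|[c [cm cK h]]] := ih (ltnW mn); first by left.
(* An infinite coordinate passes this test vacuously; failure yields a finite [p] with
   [sumn c + p <= K], which extends [c]. *)
have [hm|] := pselect (forall i : 'I_n, i = size c :> nat -> forall p, w i = Some p ->
    (K.+1 - sumn c <= p)%N).
  by left; exists c; split; [rewrite cm ltnW| |exact: boxI].
move=> /existsNP[i /not_implyP[ic /existsNP[p /not_implyP[wp /negP]]]].
rewrite -ltnNge ltn_subRL ltnS => pK; right; exists (rcons c p).
split; rewrite ?size_rcons ?cm ?sumn_rcons// => l.
rewrite nth_rcons ltnS leq_eqVlt cm => /orP[/eqP lm|lm].
  by rewrite lm ltnn eqxx -wp; congr w; apply: val_inj; rewrite /= ic cm.
by rewrite lm h ?cm.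
Qed.

End Compositions.

(** * The two signs of the degree *)

Lemma box_shift_line (n m : nat) : box_shift m%:Z (fun=> false)
  (fun i : 'I_n => if i == 0%N :> nat then m else 0%N) (fun=> 0%N).
Proof.
split => [i j _ ij|//|i _].
  by split => //; case: eqP => // j0; rewrite j0 in ij.
(* The displacement is [- m] in the first coordinate and 0 elsewhere, so the condition reads
   [- m = - m] there and [0 = - m + m] afterwards. *)
have [i0|i0] := eqVneq (i : nat) 0%N.
  by rewrite sub0r big_pred0 ?subr0// => j; rewrite i0.
have n0 : (0 < n)%N by exact: leq_ltn_trans (ltn_ord i).
rewrite (bigD1 (Ordinal n0))/= ?lt0n// big1 ?addr0 ?sub0r ?opprK ?addNr//.
move=> j /andP[_]; rewrite -val_eqE/= => /negbTE ->; exact: subrr.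
Qed.

Unset Implicit Arguments.

Theorem theorem3 (R : realType) (n : nat) (k : int) (A : cstarAlgType R)
    (iota : (Fn n -> R[i]) -> A) (rho : R[i] -> A -> A) :
  (1 <= n)%N ->
  is_groupoid_cstar iota ->
  is_gauge_action iota rho ->
  let CP := spectral rho 0 in
  let L := spectral rho k in
  (k <= 0 ->
    represents (line_char R `|k|%N) (@line_proj R n `|k|%N) /\
    left_module_iso CP L
      (proj_module CP ((iota (line_char R `|k|%N))%:M : 'M[A]_1))) /\
  (0 < k ->
    (forall j, (j <= n)%N ->
       represents (corner_char R j) (@corner_proj R n j)) /\
    left_module_iso CP L
      (proj_module CP
        (\mxdiag_(j < n.+1)
           ((iota (corner_char R j))%:M : 'M[A]_('C((`|k| + j - 1)%N, j)))))).
Proof.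
move=> _ iotaH gaugeH CP L; split => [k0|k0].
  split; first exact: represents_line.
  rewrite (_ : _%:M = \matrix_(p, q) (iota (line_char R `|k|%N) *+ (p == q)));
    last by apply/matrixP => p q; rewrite !mxE.
  (* One bisection suffices: its target box is the whole unit space. *)
  rewrite line_charE; apply: (box_frame_left_module_iso iotaH gaugeH (N := 1)
    (F := fun _ _ => false) (r := fun _ _ => 0%N)).
  - by move=> _; rewrite -(ler0_norm k0) -abszE; exact: box_shift_line.
  - by move=> w; exists 0.
  - by move=> p q w _ _; rewrite !ord1.
split; first by move=> j _; exact: represents_corner.
have [K kE] : exists K : nat, `|k|%N = K.+1.
  by exists `|k|.-1%N; rewrite prednK// absz_gt0 gt_eqF.
have {k0}kK : k = K.+1%:Z by rewrite -kE gtz0_abs.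
rewrite kE.
under eq_mxdiag => j.
  rewrite (_ : _%:M = \matrix_(p, q) (iota (corner_char R j) *+ (p == q)));
    last by apply/matrixP => p q; rewrite !mxE.
  over.
rewrite mxdiag_scalar.
(* The index [p] encodes a length [j] and a position among the sequences of that length. *)
pose c p := bounded_seq (tagged (@tagnat.sig n.+1 (fun j => 'C(K.+1 + j - 1, j)) p)).
have szc p : size (c p) = tagnat.sig1 p by exact: size_bounded_seq.
have cn p : (size (c p) <= n)%N by rewrite szc -ltnS.
have cK p : (sumn (c p) <= K)%N by exact: sumn_bounded_seq.
rewrite (_ : \matrix_(_, _) _ = \matrix_(p, q)
    (iota (unit_char R (box (fun i : 'I_n => (i < size (c p))%N) (fun=> 0%N))) *+ (p == q)));
  last by apply/matrixP => p q; rewrite !mxE corner_charE szc.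
apply: (box_frame_left_module_iso iotaH gaugeH (s := fun _ _ => 0%N)
  (r := fun p i => target_lo K (c p) i)).
- by move=> p; rewrite kK; exact: box_shift_target.
- move=> w; have [d [dn dK bd]] := box_target_cover K w.
  have [i di] := bounded_seq_surj dK.
  exists (tagnat.rank (existT (fun j : 'I_n.+1 => 'I_('C(K.+1 + j - 1, j)))
    (Ordinal (dn : (size d < n.+1)%N)) i)).
  by rewrite /c tagnat.rankK/= di.
- move=> p q w bp bq; have := box_target_inj (cn p) (cn q) (cK p) (cK q) bp bq.
  rewrite /c => e; apply: (can_inj tagnat.sigK); move: e.
  case: (tagnat.sig p) (tagnat.sig q) => [j i] [j' i'] /= e.
  (* Equal sequences have equal lengths, so both indices lie in the same block, where the
     enumeration is injective. *)
  have jj' : j = j'.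
    by apply: val_inj; have := congr1 size e; rewrite !size_bounded_seq.
  by case: _ / jj' i' e => i' /bounded_seq_inj ->.
Qed.
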